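(* Every positive integer $n$ has finite fixed point order; that is, for every positive integer $n$, either $n$ is a fixed point of $z$ or there exists a positive integer $k$ such that $z^k(n)$ is a fixed point of $z$.
   Context: The Fibonacci sequence is defined by $F_0=0$, $F_1=1$, $F_n=F_{n-1}+F_{n-2}$ for $n\ge 2$. For a positive integer $n$, the order of appearance $z(n)$ is the smallest positive integer $\ell$ such that $n\mid F_\ell$ (it exists for every $n \geq 1$). For $k\ge 1$, $z^k(n)$ denotes the $k$-th iterate of $z$ applied to $n$ (so $z^1(n)=z(n)$ and $z^{k+1}(n)=z(z^k(n))$). A fixed point of $z$ is a positive integer $n$ with $z(n)=n$. The fixed point order of a positive integer $n$ is $0$ if $n$ is a fixed point; otherwise it is the smallest positive integer $k$ such that $z^k(n)$ is a fixed point, if such a $k$ exists. *)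

(* Defs.v *)
From mathcomp Require Import all_boot zmodp.

Set Implicit Arguments.
Unset Strict Implicit.
Unset Printing Implicit Defensive.

Fixpoint fib (n : nat) : nat :=
  match n with
  | 0 => 0
  | n1.+1 => match n1 with 0 => 1 | n2.+1 => fib n1 + fib n2 end
  end.

(* The map (a, b) |-> (b, a + b) is a permutation of the finite set of pairs
   of residues, so the orbit of (F_0, F_1) is periodic. *)
Lemma fib_divisible_index (n : nat) : exists l, (0 < l) && (n.+1 %| fib l).
Proof.
pose f (p : 'I_n.+1 * 'I_n.+1) : 'I_n.+1 * 'I_n.+1 := (p.2, inZp (p.1 + p.2)).
have f_inj : injective f.
  move=> [a b] [c d] [->] /eqP; rewrite eqn_modDr !modn_small // => /eqP eq_ac.
  by rewrite (val_inj eq_ac).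
pose x0 : 'I_n.+1 * 'I_n.+1 := (inZp 0, inZp 1).
have f_iter k : iter k f x0 = (inZp (fib k), inZp (fib k.+1)).
  elim: k => [//|k IHk]; rewrite iterS IHk /f /=; congr pair.
  by apply/val_inj; rewrite /= modnDm addnC.
exists (order f x0); rewrite order_gt0 /=.
have := f_iter (order f x0); rewrite (iter_order f_inj) => -[h0 _].
by rewrite /dvdn -h0 mod0n.
Qed.

(* z 0 = 0 is a junk value: the order of appearance is only defined for n > 0. *)
Definition z (n : nat) : nat :=
  match n with
  | 0 => 0
  | n'.+1 => ex_minn (fib_divisible_index n')
  end.

Lemma zP (n : nat) : 0 < n ->
  [/\ 0 < z n, n %| fib (z n)
    & forall l, 0 < l -> n %| fib l -> z n <= l].
Proof.
case: n => // n _ /=; case: ex_minnP => l /andP[l_gt0 dvd_l] min_l.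
by split=> // m m_gt0 dvd_m; apply: min_l; rewrite m_gt0.
Qed.

Definition fixed_point (n : nat) : Prop := 0 < n /\ z n = n.

Definition fixed_point_order (n d : nat) : Prop :=
  (fixed_point n /\ d = 0) \/
  [/\ ~ fixed_point n, 0 < d, fixed_point (iter d z n)
    & forall k, 0 < k -> fixed_point (iter k z n) -> d <= k].

Definition finite_fixed_point_order (n : nat) : Prop :=
  exists d, fixed_point_order n d.

(* Main.v *)
(* If p >= 7 is the largest prime factor of n, then z p divides (p - 1)(p + 1),
   whose prime factors are all smaller than p, and z (p^e) divides
   p^(e - 1) (z p); hence z lowers the exponent of p, and iterating z leads to
   a number whose prime factors are among 2, 3 and 5.  On these,
   z (2^(k+3)) | 3 * 2^(k+1) and z (3^(k+1)) = 4 * 3^k bring the orbit to a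
   divisor of 12 * 5^c.  There z acts as 1 -> 1, 2 -> 3 -> 4 -> 6 -> 12 -> 12 on
   the divisor of 12 and decreases the power of 5 for divisibility, so that
   eventually z m | m.  As z is monotone for divisibility, the orbit is then a
   divisor chain, which becomes stationary. *)

Require Import Defs.
From mathcomp Require Import all_boot.
From mathcomp Require Import ssralg zmodp matrix ring.

Set Implicit Arguments.
Unset Strict Implicit.
Unset Printing Implicit Defensive.

(** * Addition formula and divisibility of Fibonacci numbers *)

Lemma fibSS n : fib n.+2 = fib n.+1 + fib n.
Proof. by []. Qed.

Lemma fib_add m n : fib (m + n).+1 = fib m.+1 * fib n.+1 + fib m * fib n.
Proof.
elim: m n => [|m IHm] n; first by rewrite mul1n addn0.
by rewrite addSnnS IHm !fibSS; ring.
Qed.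

Lemma coprime_fibS n : coprime (fib n) (fib n.+1).
Proof.
elim: n => [//|n IHn]; rewrite fibSS /coprime gcdnDl gcdnC; exact: IHn.
Qed.

(** For l > 0, F_(m+l) = F_(m+1) F_l + F_m F_(l-1), and F_(l-1) is coprime to F_l, hence to d. *)
Lemma dvdn_fib_addr d m l : d %| fib l -> (d %| fib (m + l)) = (d %| fib m).
Proof.
case: l => [|l] dvd_l; first by rewrite addn0.
rewrite addnS fib_add dvdn_addr; last exact: dvdn_mull.
have co_d : coprime d (fib l).
  rewrite coprime_sym; apply: coprime_dvdr dvd_l _; exact: coprime_fibS.
by rewrite Gauss_dvdl.
Qed.

Lemma dvdn_fib_mull d k l : d %| fib l -> d %| fib (k * l).
Proof.
by move=> dvd_l; elim: k => [//|k IHk]; rewrite mulSn addnC dvdn_fib_addr.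
Qed.

Lemma dvdn_fib_dvd d l m : l %| m -> d %| fib l -> d %| fib m.
Proof. by move=> /dvdnP[k ->]; apply: dvdn_fib_mull. Qed.

(** * Divisibility properties of the order of appearance *)

Lemma z_gt0 n : 0 < n -> 0 < z n.
Proof. by case/zP. Qed.

Lemma dvdn_fib_z n : 0 < n -> n %| fib (z n).
Proof. by case/zP. Qed.

Lemma z_dvdn n l : 0 < n -> (z n %| l) = (n %| fib l).
Proof.
move=> n_gt0; have [z_pos dvd_z min_z] := zP n_gt0.
apply/idP/idP => [/dvdn_fib_dvd|]; first exact.
rewrite {1}(divn_eq l (z n)) addnC dvdn_fib_addr ?dvdn_fib_mull // => dvd_r.
rewrite /dvdn; apply/eqP; case: (posnP (l %% z n)) => // r_gt0.
by have := min_z _ r_gt0 dvd_r; rewrite leqNgt ltn_pmod.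
Qed.

Lemma z_mono m n : 0 < n -> m %| n -> z m %| z n.
Proof.
move=> n_gt0 dvd_mn; rewrite z_dvdn ?(dvdn_gt0 n_gt0) //.
exact: dvdn_trans dvd_mn (dvdn_fib_z n_gt0).
Qed.

Lemma z_lcm m n : 0 < m -> 0 < n -> z (lcmn m n) = lcmn (z m) (z n).
Proof.
move=> m_gt0 n_gt0; have lcm_pos : 0 < lcmn m n by rewrite lcmn_gt0 m_gt0.
apply/eqP; rewrite eqn_dvd dvdn_lcm !z_mono ?dvdn_lcml ?dvdn_lcmr // !andbT.
by rewrite z_dvdn // dvdn_lcm -!z_dvdn // dvdn_lcml dvdn_lcmr.
Qed.

(** Evaluates [z] at small arguments: the last premise is decided by computation. *)
Lemma z_eq n l : 0 < n -> 0 < l -> n %| fib l ->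
  all (fun m => ~~ (n %| fib m)) (iota 1 l.-1) -> z n = l.
Proof.
move=> n_gt0 l_gt0 dvd_l /allP min_l; have [z_pos dvd_z min_z] := zP n_gt0.
apply/eqP; rewrite eqn_leq min_z //= leqNgt; apply/negP => lt_zl.
have := min_l (z n); rewrite dvd_z mem_iota z_pos add1n prednK // lt_zl.
by move/(_ isT).
Qed.

(** * Multiples of an index *)

(** With N = l + 1, this gives F_(kN+1) modulo F_N and F_(kN) modulo F_N^2, using that F_(N+1) is
    congruent to F_(N-1) modulo F_N. *)
Lemma fib_mul_expansion l k : exists u v,
  fib (k * l.+1).+1 = fib l ^ k + fib l.+1 * u /\
  fib (k * l.+1) = k * fib l.+1 * fib l ^ k.-1 + fib l.+1 ^ 2 * v.
Proof.
elim: k => [|k [u [v [eq1 eq0]]]]; first by exists 0, 0; rewrite !muln0.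
have -> : k.+1 * l.+1 = (k * l.+1 + l).+1 by rewrite mulSn addnC addnS.
rewrite fib_add -(addnS _ l) fib_add fibSS eq1 /=.
exists (fib l ^ k + u * (fib l.+1 + fib l) + fib (k * l.+1)).
have [k0 | k_gt0] := posnP k.
  by exists u; rewrite k0 mul0n expn0 expn1 /=; split; ring.
exists (u + v * fib l); split; first by rewrite expnS; ring.
by rewrite eq0 -(prednK k_gt0) /= expnS; ring.
Qed.

(** In the expansion of F_(pl), the first term has the factor p F_l and the second F_l^2. *)
Lemma dvdn_fib_mul p m l :
  p %| fib l -> m %| fib l -> p * m %| fib (p * l).
Proof.
case: l => [|l]; first by rewrite !muln0 dvdn0.
move=> dvd_p dvd_m; have [u [v [_ ->]]] := fib_mul_expansion l p.
by rewrite dvdn_add // dvdn_mulr // ?dvdn_mul.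
Qed.

(** * Fibonacci numbers modulo a prime *)

Section FibModPrime.
Import GRing.Theory.
Local Open Scope ring_scope.

Lemma exp_golden (R : nzRingType) (x : R) n :
  x * x = x + 1 -> x ^+ n.+1 = x *+ fib n.+1 + (fib n)%:R.
Proof.
move=> xx; elim: n => [|n IHn]; first by rewrite addr0.
rewrite exprS IHn mulrDr !mulrnAr mulr1 xx fibSS mulrnDl mulrnDr.
by rewrite addrAC.
Qed.

Lemma fib_cassini (R : comNzRingType) n :
  (fib n)%:R * (fib n.+2)%:R - (fib n.+1)%:R ^+ 2 = (-1) ^+ n.+1 :> R.
Proof.
elim: n => [|n IHn]; first by rewrite mul0r sub0r expr1n expr1.
by rewrite [RHS]exprS -IHn !fibSS !natrD; ring.
Qed.

Lemma pchar_mx p : prime p -> p \in [pchar 'M['F_p]_2].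
Proof.
by move=> /pchar_Fp; apply: (rmorph_pchar (@scalar_mx 'F_p 2)).
Qed.

(** The Fibonacci matrix, with rows (0, 1) and (1, 1), replaces a root in a quadratic extension. *)
Lemma golden_mx p : exists x : 'M['F_p]_2, x * x = x + 1.
Proof.
exists (\matrix_(i, j) (~~ ((i == 0) && (j == 0)))%:R).
apply/matrixP => i j; rewrite !mxE !big_ord_recl big_ord0 !mxE.
case: i => [[|[|//]] ?]; case: j => [[|[|//]] ?] /=;
  by rewrite ?mulr0n ?mulr1n; ring.
Qed.

(* The Lucas number L_p = F_p + 2 F_(p-1) is 1 modulo p: apply the Frobenius
   map to x + (1 - x) = 1, where x and 1 - x are both roots of X^2 = X + 1. *)
Lemma lucas_prime_mod p : prime p ->
  (fib p + (fib p.-1).*2)%:R = 1 :> 'F_p.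
Proof.
move=> p_pr; have [x xx] := golden_mx p; have pM := pchar_mx p_pr.
have p_gt0 := prime_gt0 p_pr.
have yy : (1 - x) * (1 - x) = (1 - x) + 1.
  rewrite mulrBr mulr1 mulrBl mul1r xx opprB.
  by rewrite (addrC x 1) addrK.
have comm_xy : GRing.comm x (1 - x).
  by rewrite /GRing.comm mulrBl mulrBr mulr1 mul1r.
have := pFrobenius_autD_comm pM comm_xy.
have exp_p (u : 'M['F_p]_2) : u * u = u + 1 -> u ^+ p = u *+ fib p + (fib p.-1)%:R.
  by move=> uu; have := exp_golden p.-1 uu; rewrite prednK.
rewrite addrC subrK pFrobenius_aut1 !pFrobenius_autE !exp_p //.
rewrite addrACA -mulrnDl (addrC x) subrK -natrD addnn -natrD.
(* The identity passes from matrices to ['F_p] as p | L_p - 1, both rings having characteristic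
   p. *)
move=> eq1; have Lgt0 : (0 < fib p + (fib p.-1).*2)%N.
  by rewrite lt0n; apply/eqP => E; move/eqP: eq1; rewrite E oner_eq0.
apply/eqP; rewrite -subr_eq0 -[1]/(1%:R) -natrB // -(dvdn_pcharf (pchar_Fp p_pr)).
by rewrite (dvdn_pcharf pM) natrB // -eq1 subrr.
Qed.

(** With a = F_(p-1) and b = F_p, Cassini gives a(a + b) - b^2 = -1 and the Lucas congruence b = 1 -
    2a. So 5a(a + b) = 0 modulo p, and p divides F_(p-1) or F_(p+1). *)
Lemma dvdn_fib_prime p : prime p -> p != 2%N -> p != 5%N ->
  p %| fib (p.-1 * p.+1).
Proof.
move=> p_pr p_neq2 p_neq5; have p_gt0 := prime_gt0 p_pr.
have pF := pchar_Fp p_pr.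
have odd_p : odd p by case: (even_prime p_pr) p_neq2 => // ->.
have := lucas_prime_mod p_pr; have := fib_cassini 'F_p p.-1.
rewrite fibSS prednK // -signr_odd odd_p expr1 -addnn !natrD.
set a := (fib p.-1)%:R; set b := (fib p)%:R => cas luc.
have b_eq : b = 1 - a - a by rewrite -luc; ring.
have : 5%:R * (a * (b + a)) = 0 :> 'F_p.
  have -> : 5%:R * (a * (b + a)) = a * (b + a) - b ^+ 2 + 1.
    by rewrite b_eq; ring.
  by rewrite cas addNr.
rewrite -natrD; have -> : (fib p + fib p.-1)%N = fib p.+1.
  by rewrite -{1 3}(prednK p_gt0).
rewrite -!natrM => /eqP; rewrite -(dvdn_pcharf pF) Euclid_dvdM //.
rewrite dvdn_prime2 // (negPf p_neq5) /= Euclid_dvdM // => /orP[] dvd_p.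
  by rewrite mulnC dvdn_fib_mull.
by rewrite dvdn_fib_mull.
Qed.

End FibModPrime.

(** * Prime powers and smooth numbers *)

Lemma dvdn_fib_exp p l e :
  0 < p -> p %| fib l -> p ^ e.+1 %| fib (p ^ e * l).
Proof.
move=> p_gt0 dvd_p; elim: e => [|e IHe]; first by rewrite expn1 mul1n.
rewrite expnS [in fib _]expnS -mulnA; apply: dvdn_fib_mul IHe.
exact: dvdn_fib_mull.
Qed.

Lemma pnat_ltn_pred p : prime p -> p != 2 ->
  [pred q | q < p].-nat (p.-1 * p.+1).
Proof.
move=> p_pr p_neq2; have p_gt1 := prime_gt1 p_pr.
have odd_p : odd p by case: (even_prime p_pr) p_neq2 => // ->.
have pred_gt0 : 0 < p.-1 by rewrite -ltnS prednK // ltnW.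
apply/pnatP => [|q q_pr]; first by rewrite muln_gt0 pred_gt0.
rewrite inE Euclid_dvdM // => /orP[/(dvdn_leq pred_gt0) le_q|dvd_q].
  by apply: leq_ltn_trans le_q _; rewrite prednK // ltnW.
(* Besides q < p, this leaves q = p + 1, which is even, and q = p, which would divide 1. *)
have := dvdn_leq (ltn0Sn p) dvd_q; rewrite leq_eqVlt ltnS leq_eqVlt => /or3P[] //.
  move/eqP=> q_eq; case: (even_prime q_pr); last by rewrite q_eq /= odd_p.
  by rewrite q_eq => -[p_eq]; rewrite p_eq in p_gt1.
move/eqP=> q_eq; move: dvd_q; rewrite q_eq -addn1 dvdn_addr // dvdn1 => /eqP p1.
by rewrite p1 in p_gt1.
Qed.

(** A prime p is peeled off n; the index for n / p is multiplied by p and by an index for p, namely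
    3, 5 or (p - 1)(p + 1). *)
Lemma smooth_fib_multiple b n : 5 < b -> [pred p | p < b].-nat n ->
  exists l, [/\ 0 < l, [pred p | p < b].-nat l & n %| fib l].
Proof.
move=> b_gt5; elim/ltn_ind: n => n IHn sm_n.
have n_gt0 : 0 < n by case/andP: sm_n.
have [n_le1 | n_gt1] := leqP n 1.
  by exists 1; split=> //; rewrite (@anti_leq n 1) // n_le1.
have p_pr := pdiv_prime n_gt1; set p := pdiv n in p_pr.
have [m def_n] := dvdnP (pdiv_dvd n); rewrite -/p in def_n.
have m_gt0 : 0 < m by move: n_gt0; rewrite def_n muln_gt0 => /andP[].
move: sm_n; rewrite def_n pnatM => /andP[sm_m sm_p].
have [|l [l_gt0 sm_l dvd_l]] := IHn m _ sm_m.
  by rewrite def_n ltn_Pmulr // prime_gt1.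
have lt_pb : p < b by move: sm_p; rewrite pnatE.
suff [l' [l'_gt0 sm_l' dvd_l']] :
    exists l', [/\ 0 < l', [pred p | p < b].-nat l' & p %| fib l'].
  exists (p * (l * l')); split.
  - by rewrite !muln_gt0 prime_gt0 // l_gt0.
  - by rewrite !pnatM sm_p sm_l.
  rewrite mulnC dvdn_fib_mul //; last by rewrite mulnC dvdn_fib_mull.
  by rewrite dvdn_fib_mull.
have [->|p_neq2] := eqVneq p 2.
  by exists 3; split=> //; rewrite pnatE //= inE (ltn_trans _ b_gt5).
have [->|p_neq5] := eqVneq p 5; first by exists 5; rewrite pnatE.
exists (p.-1 * p.+1); split; last exact: dvdn_fib_prime.
  by rewrite muln_gt0 andbT -ltnS prednK ?prime_gt1 ?prime_gt0.
apply: sub_in_pnat (pnat_ltn_pred p_pr p_neq2) => q _; rewrite !inE => /ltn_trans.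
exact.
Qed.

Lemma z_drops_largest_prime n b : 0 < n -> prime b -> 5 < b -> b %| n ->
  [pred p | p < b.+1].-nat n ->
  [pred p | p < b.+1].-nat (z n) /\ logn b (z n) < logn b n.
Proof.
move=> n_gt0 b_pr b_gt5 dvd_b sm_n; have b_gt0 := prime_gt0 b_pr.
have b_neq2 : b != 2 by apply: contraTneq b_gt5 => ->.
have b_neq5 : b != 5 by apply: contraTneq b_gt5 => ->.
have sm_m : [pred p | p < b].-nat n`_b^'.
  apply/pnatP => [|q q_pr dvd_q]; first exact: part_gt0.
  have := pnatP _ n_gt0 sm_n _ q_pr (dvdn_trans dvd_q (dvdn_part _ _)).
  rewrite !inE ltnS leq_eqVlt => /orP[/eqP q_eq|//].
  by have := pnatP _ (part_gt0 _ n) (part_pnat b^' n) _ q_pr dvd_q; rewrite q_eq !inE eqxx.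
have [l [l_gt0 sm_l dvd_l]] := smooth_fib_multiple b_gt5 sm_m.
set c := b.-1 * b.+1; set e := (logn b n).-1.
have c_sm : [pred p | p < b].-nat c := pnat_ltn_pred b_pr b_neq2.
have log_gt0 : 0 < logn b n by rewrite logn_gt0 mem_primes b_pr n_gt0.
(* As b already divides F_c, one factor b of n costs nothing in the index. *)
have dvd_z : z n %| b ^ e * (c * l).
  rewrite z_dvdn // -(partnC b n_gt0) Gauss_dvd ?coprime_partC //.
  rewrite mulnA (dvdn_fib_mull _ dvd_l) andbT p_part -(prednK log_gt0).
  by rewrite mulnC dvdn_fib_mull // dvdn_fib_exp // dvdn_fib_prime.
have cl_sm : [pred p | p < b].-nat (c * l) by rewrite pnatM c_sm.
have cl_gt0 : 0 < c * l by case/andP: cl_sm.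
have bd_gt0 : 0 < b ^ e * (c * l) by rewrite muln_gt0 expn_gt0 b_gt0.
split.
  apply: pnat_dvd dvd_z _; rewrite pnatM pnatX pnatE // inE ltnSn /=.
  by apply: sub_in_pnat cl_sm => q _; rewrite !inE => /ltnW.
apply: leq_ltn_trans (dvdn_leq_log _ bd_gt0 dvd_z) _.
rewrite lognM ?expn_gt0 ?b_gt0 // pfactorK // lognE b_pr cl_gt0 /=.
case: ifP => [dvd_cl|_]; last by rewrite addn0 prednK.
by have := pnatP _ cl_gt0 cl_sm _ b_pr dvd_cl; rewrite inE ltnn.
Qed.

(** * Orbits and divisor chains *)

Definition reaches_fixed_point n := exists k, fixed_point (iter k z n).

Lemma reaches_iter k n : reaches_fixed_point (iter k z n) -> reaches_fixed_point n.
Proof. by case=> j fix_j; exists (j + k); rewrite iterD. Qed.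

Lemma reaches_dvd n : 0 < n -> z n %| n -> reaches_fixed_point n.
Proof.
elim/ltn_ind: n => n IHn n_gt0 dvd_n; have [eq_n|neq_n] := eqVneq (z n) n.
  by exists 0.
apply: (@reaches_iter 1); apply: IHn; rewrite ?z_gt0 ?z_mono //=.
by rewrite ltn_neqAle neq_n dvdn_leq.
Qed.

Lemma iter_z_gt0 k n : 0 < n -> 0 < iter k z n.
Proof. by move=> n_gt0; elim: k => //= k /z_gt0. Qed.

Lemma iter_z_lcm k m n : 0 < m -> 0 < n ->
  iter k z (lcmn m n) = lcmn (iter k z m) (iter k z n).
Proof.
by move=> m_gt0 n_gt0; elim: k => //= k ->; rewrite z_lcm ?iter_z_gt0.
Qed.

(** * The primes 2, 3 and 5 *)

Lemma dvdn_fib_5exp c : 5 ^ c %| fib (5 ^ c).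
Proof. by case: c => // c; rewrite [in fib _]expnSr dvdn_fib_exp. Qed.

(** Four steps suffice for the longest orbit 2, 3, 4, 6, 12. *)
Lemma iter_z_dvd12 d : d %| 12 -> iter 5 z d %| iter 4 z d.
Proof.
have z1 : z 1 = 1 by apply: z_eq.
have z2 : z 2 = 3 by apply: z_eq.
have z3 : z 3 = 4 by apply: z_eq.
have z4 : z 4 = 6 by apply: z_eq.
have z6 : z 6 = 12 by apply: z_eq.
have z12 : z 12 = 12 by apply: z_eq.
rewrite dvdn_divisors // => d12.
have {d12} : d \in [:: 1; 2; 3; 4; 6; 12] by [].
rewrite !inE => /or4P[/eqP->|/eqP->|/eqP->|/or3P[]/eqP->];
  by rewrite /iter ?(z1, z2, z3, z4, z6, z12).
Qed.

(** As [z] commutes with lcm, the parts of n in 12 and in 5^c evolve separately. *)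
Lemma reaches_dvd_12_5exp n c : n %| 12 * 5 ^ c -> reaches_fixed_point n.
Proof.
move=> dvd_n; have co_c : coprime 12 (5 ^ c) by rewrite coprimeXr.
have n_gt0 : 0 < n by apply: dvdn_gt0 dvd_n; rewrite muln_gt0 expn_gt0.
set d := gcdn n 12; set f := gcdn n (5 ^ c).
have d_gt0 : 0 < d by rewrite gcdn_gt0 n_gt0.
have f_gt0 : 0 < f by rewrite gcdn_gt0 n_gt0.
have def_n : n = lcmn d f.
  apply/eqP; rewrite eqn_dvd dvdn_lcm !dvdn_gcdl !andbT.
  have co_df : coprime d f.
    exact: coprime_dvdl (dvdn_gcdr _ _) (coprime_dvdr (dvdn_gcdr _ _) co_c).
  apply: (@dvdn_trans (d * f)).
    (* d f is the gcd of n^2, 5^c n, 12 n and 12 * 5^c, all multiples of n. *)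
    by rewrite /d /f muln_gcdl !muln_gcdr !dvdn_gcd dvd_n (dvdn_mull 12) // !dvdn_mulr.
  by rewrite Gauss_dvd // dvdn_lcml dvdn_lcmr.
have dvd_f : z f %| f.
  have /dvdn_pfactor[//|j _ ->] : f %| 5 ^ c by apply: dvdn_gcdr.
  by rewrite z_dvdn ?expn_gt0 // dvdn_fib_5exp.
apply: (@reaches_iter 4); apply: reaches_dvd; first exact: iter_z_gt0.
rewrite -iterS def_n !iter_z_lcm // dvdn_lcm.
rewrite (dvdn_trans (iter_z_dvd12 (dvdn_gcdr _ _))) ?dvdn_lcml //=.
apply: dvdn_trans (dvdn_lcmr _ _).
have dvd_iter j : iter j.+1 z f %| iter j z f.
  by elim: j => //= j; apply: z_mono; rewrite iter_z_gt0.
exact: (dvd_iter 4).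
Qed.

(** Starts from F_12 = 144. Since 72 * 6^k = 12 * 6^(k+1), it lets [z] lower the exponents of 2 and
    3 together. *)
Lemma dvdn_fib_12_6exp k : 72 * 6 ^ k %| fib (12 * 6 ^ k).
Proof.
elim: k => // k IHk; rewrite expnS !(mulnCA _ 6); apply: dvdn_fib_mul IHk.
by rewrite mulnC dvdn_fib_mull.
Qed.

Lemma reaches_dvd_12_6exp_5exp n k c :
  n %| 12 * 6 ^ k * 5 ^ c -> reaches_fixed_point n.
Proof.
elim: k n => [|k IHk] n dvd_n; first exact: reaches_dvd_12_5exp dvd_n.
have n_gt0 : 0 < n by apply: dvdn_gt0 dvd_n; rewrite !muln_gt0 !expn_gt0.
apply: (@reaches_iter 1); apply: IHk; rewrite /= z_dvdn //.
apply: dvdn_trans dvd_n _; rewrite expnS mulnA Gauss_dvd; last first.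
  by rewrite coprimeXr // coprimeMl coprimeXl.
rewrite (dvdn_fib_mull _ (dvdn_fib_5exp c)) andbT [in fib _]mulnC.
exact: dvdn_fib_mull (dvdn_fib_12_6exp k).
Qed.

Lemma reaches_smooth6 n : [pred p | p < 6].-nat n -> reaches_fixed_point n.
Proof.
move=> sm_n; have n_gt0 : 0 < n by case/andP: sm_n.
(* n is a generous exponent: [logn p n <= n], and p divides 30 = 6 * 5. *)
apply: (@reaches_dvd_12_6exp_5exp n n n).
apply/dvdn_partP => // p p_n; rewrite p_part.
have : p \in [:: 2; 3; 5].
  have [p_pr dvd_p] : prime p /\ p %| n by move: p_n; rewrite mem_primes n_gt0 => /andP[].
  have := pnatP _ n_gt0 sm_n _ p_pr dvd_p; rewrite inE; move: p_pr.
  by move: p {p_n dvd_p}; do 6!case=> //.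
have le_log : logn p n <= n by apply: ltnW; rewrite ltn_logl.
rewrite -mulnA => p235; apply: dvdn_trans (dvdn_exp2l p le_log) _.
apply: dvdn_mull; rewrite -expnMn; apply: dvdn_exp2r.
by move: p235; rewrite !inE => /or3P[]/eqP->.
Qed.

(** * Descent on the largest prime factor *)

(** Induction on b, then on a bound e for the exponent of b in n: [z] lowers this exponent, and once
    b is not a prime factor of n, the outer hypothesis applies. *)
Lemma reaches_smooth b n : [pred p | p < b].-nat n -> reaches_fixed_point n.
Proof.
elim: b n => [|b IHb] n sm_n.
  by apply: reaches_smooth6; apply: sub_in_pnat sm_n.
have [b_le5 | b_gt5] := leqP b 5.
  apply: reaches_smooth6; apply: sub_in_pnat sm_n => q _; rewrite !inE => lt_q.
  exact: leq_trans lt_q _.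
move: {2}(logn b n) (leqnn (logn b n)) => e; elim: e n sm_n => [|e IHe] n sm_n.
all: have n_gt0 : 0 < n by case/andP: sm_n.
all: case dvd_b: (prime b && (b %| n)) => le_e.
- by move: le_e; rewrite lognE n_gt0 /= dvd_b.
2: have [b_pr dvd_n] := andP dvd_b.
2: have [sm_z lt_z] := z_drops_largest_prime n_gt0 b_pr b_gt5 dvd_n sm_n.
2: apply: (@reaches_iter 1); apply: IHe => //.
2: by rewrite -ltnS (leq_trans lt_z).
all: apply: IHb; apply/pnatP => // q q_pr dvd_q.
all: have := pnatP _ n_gt0 sm_n _ q_pr dvd_q.
all: rewrite !inE ltnS leq_eqVlt => /orP[/eqP q_eq|//].
all: by rewrite -q_eq q_pr dvd_q in dvd_b.
Qed.

Theorem theorem1p5 (n : nat) (hn : 0 < n) :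
  finite_fixed_point_order n /\
  (fixed_point n \/ exists k : nat, 0 < k /\ fixed_point (iter k z n)).
Proof.
have [k fix_k] : reaches_fixed_point n.
  apply: (@reaches_smooth n.+1); apply/pnatP => // p _ dvd_p.
  by rewrite inE ltnS dvdn_leq.
have [fix_n | nfix_n] := eqVneq (z n) n.
  by split; [exists 0; left | left].
have not_fix : ~ fixed_point n by case=> _ /eqP; apply/negP.
have k_gt0 : 0 < k by case: k fix_k => // /not_fix.
split; last by right; exists k.
(* Positivity of the orbit makes [fixed_point] a boolean test, as [ex_minn] requires. *)
have fixE j : fixed_point (iter j z n) <-> z (iter j z n) == iter j z n.
  by split=> [[_ /eqP]|/eqP] //; split; first exact: iter_z_gt0.
have ex_d : exists d, (0 < d) && (z (iter d z n) == iter d z n).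
  by exists k; rewrite k_gt0; apply/fixE.
case: (ex_minnP ex_d) => d /andP[d_gt0 fix_d] min_d.
exists d; right; split=> // [|j j_gt0 /fixE fix_j]; first exact/fixE.
by apply: min_d; rewrite j_gt0.
Qed.
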